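(* For every Boolean assignment to $x\in\{0,1\}^{2n^2}$ and to the descriptor bits of the list $A\in[n]^M$ (including lists $A$ that are unsorted or contain repetitions), the count $W(A,x)$ defined in the context satisfies $W(A,x)\in\{0,1,\dots,L\}$.
   Context: Parameters. $n=2^\ell$ is a power of two, large enough that $\ell=\log_2 n\ge5$; $M:=\lfloor n^{(\ell+1)/(\ell+2)}\rfloor$ (so $1\le M<n$) and $L:=\ell n$. Fix a bijection between $\{0,1\}^\ell$ and $[n]=\{1,\dots,n\}$, so that each $\ell$-bit string names an element of $[n]$ and a list $A\in[n]^M$ is encoded by $M\ell$ descriptor bits. Fix maps $r_1,\dots,r_\ell:[n]\times[n]\to[n]$ with the property (such maps exist) that for every $S\subseteq[n]$ with $|S|\le n^{(\ell+1)/(\ell+2)}$, $|\{(i,j)\in S\times S:\ r_k(i,j)\in S\ \forall k\in[\ell]\}|\le L$. Inputs. $x\in\{0,1\}^{2n^2}$ has coordinates $x_{i,j,b}$, $i,j\in[n]$, $b\in\{1,2\}$. Membership. For a list $A=(a_1,\dots,a_M)\in[n]^M$ (not necessarily sorted) and $i\in[n]$, $\operatorname{mem}_A(i)\in\{0,1\}$ is the output of this search: start with $\lambda=1,\mu=M+1$; while $\lambda<\mu$, let $m=\lfloor(\lambda+\mu)/2\rfloor$, and if $a_m<i$ set $\lambda:=m+1$, else set $\mu:=m$; at the end output $1$ iff $\lambda\le M$ and $a_\lambda=i$. Count. For $u\ne v$ let $E_A(u,v)=\operatorname{mem}_A(u)\operatorname{mem}_A(v)\prod_{k=1}^\ell\operatorname{mem}_A(r_k(u,v))$,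 $Z_{u,v}=(1-x_{u,v,1})(1-x_{v,v,2})$, and $W(A,x)=\sum_{u\neq v}E_A(u,v)(1-Z_{u,v})$, the sum over ordered pairs of distinct $u,v\in[n]$. *)

(* Defs.v *)
From HB Require Import structures.
From mathcomp Require Import all_boot all_order all_algebra zify.
From mathcomp Require Import reals exp.

Set Implicit Arguments.
Unset Strict Implicit.
Unset Printing Implicit Defensive.

Import Order.TTheory GRing.Theory Num.Theory.
Local Open Scope ring_scope.

(* The set [n] = {1, ..., n} is represented by 'I_n with its usual order (the  *)
(* element i of [n] is the ordinal of value i - 1), and {1, 2} by 'I_2 in the  *)
(* same way.  List positions and the variables of the binary search, on the    *)
(* other hand, are natural numbers counted from 1.                             *)

Definition threshold (R : realType) (l n : nat) : R :=
  n%:R `^ (l.+1%:R / l.+2%:R).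

Definition listlen (R : realType) (l n : nat) : nat :=
  Num.truncn (threshold R l n).

Definition countbound (l n : nat) : nat := (l * n)%N.

Definition few_closed_pairs (R : realType) (l n : nat)
    (r : 'I_l -> 'I_n -> 'I_n -> 'I_n) : Prop :=
  forall S : {set 'I_n}, #|S|%:R <= threshold R l n ->
    (#|[set p : 'I_n * 'I_n | [&& p.1 \in S, p.2 \in S
          & [forall k : 'I_l, r k p.1 p.2 \in S]]]| <= countbound l n)%N.

Definition decode (l n M : nat) (name : l.-tuple bool -> 'I_n)
    (bits : {ffun 'I_M * 'I_l -> bool}) : M.-tuple 'I_n :=
  [tuple name [tuple bits (m, k) | k < l] | m < M].

Section Search.
Local Open Scope nat_scope.
Variables (n M : nat) (A : M.-tuple 'I_n) (i : 'I_n).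

(* The default value 0 is never used: the search only reads positions m with   *)
(* 1 <= m <= M.                                                                *)
Definition entry (m : nat) : nat := nth 0 [seq val a | a <- A] m.-1.

(* States are pairs (lambda, mu).  The step is idle once the loop condition    *)
(* fails, so iterating it M times runs the while loop to its end: mu - lambda  *)
(* is M at the start and decreases at every active step.                       *)
Definition search_step (s : nat * nat) : nat * nat :=
  let: (lo, hi) := s in
  if lo < hi then
    let m := (lo + hi) %/ 2 in
    if entry m < i then (m.+1, hi) else (lo, m)
  else s.

Definition search_final : nat * nat := iter M search_step (1, M.+1).

Lemma search_final_exit : ~~ (search_final.1 < search_final.2).
Proof.
suff H k : (iter k search_step (1, M.+1)).2 - (iter k search_step (1, M.+1)).1
             <= M - k by have := H M; rewrite -/search_final; lia.
elim: k => [|k] /=; first by lia.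
by case: (iter k _ _) => lo hi /=; case: ifP => [lt_lh|]; [case: ifP|] => /=; lia.
Qed.

Definition bsmem : bool :=
  (search_final.1 <= M) && (entry search_final.1 == i).

End Search.

Section Count.
Variables (l n M : nat) (r : 'I_l -> 'I_n -> 'I_n -> 'I_n).
Variables (A : M.-tuple 'I_n) (x : {ffun 'I_n * 'I_n * 'I_2 -> bool}).

Definition Eterm (u v : 'I_n) : int :=
  (bsmem A u)%:R * (bsmem A v)%:R * \prod_(k < l) (bsmem A (r k u v))%:R.

Definition Zterm (u v : 'I_n) : int :=
  (1 - (x (u, v, 0))%:R) * (1 - (x (v, v, 1))%:R).

Definition Wcount : int :=
  \sum_(u < n) \sum_(v < n | u != v) Eterm u v * (1 - Zterm u v).

End Count.

(* Main.v *)
(* Whatever the list A is, a positive answer of the search exhibits an entry of *)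
(* A equal to i, so the set S of accepted i has at most M elements, which is    *)
(* below the threshold.  Each nonzero term of W(A, x) equals 1 and comes from a *)
(* pair in S x S whose images r_k(u, v) all lie in S; there are at most L such. *)

Require Import Defs.
From HB Require Import structures.
From mathcomp Require Import all_boot all_order all_algebra.
From mathcomp Require Import reals exp.

Set Implicit Arguments.
Unset Strict Implicit.
Unset Printing Implicit Defensive.

Import Order.TTheory GRing.Theory Num.Theory.
Local Open Scope ring_scope.

(** The final test of the search compares an entry of A with i, so acceptance certifies membership
    however the search went ([bsmem_mem]). Hence S = [accepted A] has at most M elements and the
    hypothesis on r applies to it. All factors of W being 0 or 1, W is the size of a set of closed
    pairs of S ([WcountE]), which gives both bounds. *)

Definition accepted (n M : nat) (A : M.-tuple 'I_n) : {set 'I_n} :=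
  [set i | bsmem A i].

Lemma bsmem_mem (n M : nat) (A : M.-tuple 'I_n) (i : 'I_n) :
  bsmem A i -> i \in A.
Proof.
(* For M = 0 the final state computes to (1, 1), which fails the test 1 <= 0. For a nonempty list,
   lambda <= M alone puts [lambda.-1] in range, even at lambda = 0, so the default of [nth] is never
   returned. *)
case: M A => [|M] A /andP[le_M /eqP def_i]; first by [].
rewrite -(mem_map val_inj) -[val i]def_i.
apply: mem_nth; rewrite size_map size_tuple.
by case: (search_final A i).1 le_M.
Qed.

Lemma card_accepted (n M : nat) (A : M.-tuple 'I_n) : (#|accepted A| <= M)%N.
Proof.
rewrite -[leqRHS](size_tuple A); apply: leq_trans (card_size A).
by apply/subset_leq_card/subsetP => i; rewrite inE; apply: bsmem_mem.
Qed.

Lemma listlen_le_threshold (R : realType) (l n : nat) :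
  (listlen R l n)%:R <= threshold R l n.
Proof. by rewrite Num.Theory.truncn_le powR_ge0. Qed.

Lemma prodr_bool (I : finType) (b : pred I) :
  \prod_i (b i)%:R = [forall i, b i]%:R :> int.
Proof.
case: (boolP [forall i, b i]) => [/forallP b_all | /forallPn[i /negbTE bi]].
  by rewrite big1 // => i _; rewrite b_all.
by rewrite (bigD1 i) //= bi mul0r.
Qed.

Section Count.
Variables (l n M : nat) (r : 'I_l -> 'I_n -> 'I_n -> 'I_n).
Variables (A : M.-tuple 'I_n) (x : {ffun 'I_n * 'I_n * 'I_2 -> bool}).

Definition closed_pairs : {set 'I_n * 'I_n} :=
  [set p | [&& p.1 \in accepted A, p.2 \in accepted A
             & [forall k, r k p.1 p.2 \in accepted A]]].

Lemma EtermE (u v : 'I_n) : Eterm r A u v = ((u, v) \in closed_pairs)%:R.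
Proof.
rewrite /Eterm (prodr_bool (fun k => bsmem A (r k u v))) !inE /=.
under [in RHS]eq_forallb => k do rewrite inE.
by rewrite -!natrM !mulnb andbA.
Qed.

Lemma subr_Zterm (u v : 'I_n) :
  1 - Zterm x u v = (x (u, v, 0) || x (v, v, 1))%:R.
Proof. by rewrite /Zterm; case: (x (u, v, 0)); case: (x (v, v, 1)). Qed.

(** As a cardinality, W is visibly a natural number, and inclusion in [closed_pairs] bounds it. *)
Lemma WcountE :
  Wcount r A x = #|[set p in closed_pairs | (p.1 != p.2)
                     && (x (p.1, p.2, 0) || x (p.2, p.2, 1))]|%:Z.
Proof.
rewrite /Wcount pair_big_dep /= -sum1_card -natz natr_sum.
rewrite [LHS]big_mkcond [RHS]big_mkcond; apply: eq_bigr => -[u v] _ /=.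
rewrite EtermE subr_Zterm [in RHS]in_set /=.
by case: (_ \in _); case: (u != v); case: (_ || _).
Qed.

End Count.

Theorem proposition4p3 (R : realType) (l n : nat) (hn : n = (2 ^ l)%N)
    (hl : (5 <= l)%N)
    (name : l.-tuple bool -> 'I_n) (hname : bijective name)
    (r : 'I_l -> 'I_n -> 'I_n -> 'I_n) (hr : few_closed_pairs R r)
    (x : {ffun 'I_n * 'I_n * 'I_2 -> bool})
    (bits : {ffun 'I_(listlen R l n) * 'I_l -> bool}) :
  exists w : 'I_(countbound l n).+1, Wcount r (decode name bits) x = w%:Z.
Proof.
set A := decode name bits.
have cardW : (#|closed_pairs r A| <= countbound l n)%N.
  (* [closed_pairs r A] unfolds to the set bounded by [hr] at S = [accepted A]. *)
  apply: hr; apply: le_trans (listlen_le_threshold R l n).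
  by rewrite ler_nat card_accepted.
rewrite WcountE; set T := [set p in _ | _].
have T_le : (#|T| < (countbound l n).+1)%N.
  by rewrite ltnS (leq_trans _ cardW) // subset_leq_card // /T setIdE subsetIl.
by exists (Ordinal T_le).
Qed.
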